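(* Let $\varphi:\mathbb{R}^n\to\mathbb{R}\cup\{+\infty\}$ be a proper, lower semicontinuous, coercive function that is uniformly quasiconvex with modulus $\phi$ on a nonempty closed convex set $C\subseteq\operatorname{dom}\varphi$. Let $\{x^k\}_{k\ge0}$ be a sequence generated by HiPPA with order $p>1$ and parameters $\gamma_k\in(\gamma_{\min},\gamma_{\max})$, and let $\{\overline{x}\}=\arg\min_{x\in C}\varphi(x)$. For a given $\varepsilon>0$ let $\mathcal{N}(\varepsilon)$ denote the number of iterations to reach $\|\overline{x}-x^k\|<\varepsilon$. Then the following statements hold: (a) Suppose that for some $q\in(1,2)$ and some $\rho_q>0$ we have $\rho_qt^q\le\phi(t)$ on $[0,1)$, that $p\in[q,2)$, and that $\gamma_{\min}>\frac1{\rho_q}$. If the sequence starts within the unit ball centered at the minimizer $\overline{x}$ and remains there, then for a given $\varepsilon\in(0,1)$, $$\mathcal{N}(\varepsilon)\le\left\lceil1+(p-1)\frac{\log(\varepsilon^{-1})+\log(\|x^0-\overline{x}\|)}{\log(\rho_q\gamma_{\min})}\right\rceil.$$ In particular, the iteration complexity is $\mathcal{O}(\log(\varepsilon^{-1}))$. (b) If for some $\rho>0$ we have $\rho t^2\le\phi(t)$ on $[0,+\infty)$ and $p=2$, then for a given $\varepsilon>0$, $$\mathcal{N}(\varepsilon)\le\left\lceil1+\frac{\log(\varepsilon^{-1})+\log(\|x^0-\overline{x}\|)}{\log(1+\rho\gamma_{\min})}\right\rceil.$$ In particular, the iteration complexity is $\mathcal{O}(\log(\varepsilon^{-1}))$.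 (c) If $p>2$ and for some $\rho_p>0$ we have $\rho_pt^p\le\phi(t)$ on $[0,+\infty)$, then by choosing $\gamma_{\min}>\frac1{\rho_p}$, for a given $\varepsilon>0$, $$\mathcal{N}(\varepsilon)\le\left\lceil1+\frac{\log(\varepsilon^{-1})+\log(\|x^0-\overline{x}\|)}{\frac{1}{p-1}\left(\log(p\gamma_{\min}\rho_p+\widehat{\sigma}_p)-\log(p)\right)}\right\rceil,$$ where $\widehat{\sigma}_p=\left(\frac12\right)^{\frac{3p-2}{2}}$. In particular, the iteration complexity is $\mathcal{O}(\log(\varepsilon^{-1}))$. (d) Suppose that for some $q\ge2$ there exists $\rho_q>0$ such that $\rho_qt^q\le\phi(t)$ on $[0,+\infty)$, that $p>q$, and that $\|x^0-\overline{x}\|\le c^{-\frac{q-1}{p-q}}$, where $c:=(\gamma_{\min}\rho_q)^{\frac{-1}{q-1}}$. Then for a given $\varepsilon>0$, $$\mathcal{N}(\varepsilon)\le\left\lceil1+\frac{\log\left(\log\left(c^{-\frac{1}{\alpha-1}}\varepsilon^{-1}\right)\right)-\log\left(\log(u_0^{-1})\right)}{\log(\alpha)}\right\rceil,$$ where $\alpha:=\frac{p-1}{q-1}$ and $u_0=c^{\frac{1}{\alpha-1}}\|x^0-\overline{x}\|$. In particular, $$\log\left(\log\left(c^{-\frac{1}{\alpha-1}}\varepsilon^{-1}\right)\right)\ge\log\left(\log(u_0^{-1})\right),$$ and the iteration complexity is $\mathcal{O}(\log(\log(\varepsilon^{-1})))$.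
   Context: $\|\cdot\|$ is the Euclidean norm on $\mathbb{R}^n$; $\operatorname{dom}\varphi=\{x:\varphi(x)<+\infty\}$; $\varphi$ is proper if $\operatorname{dom}\varphi\ne\emptyset$, and coercive if $\varphi(x)\to+\infty$ as $\|x\|\to+\infty$. $\lceil a\rceil$ is the smallest integer greater than or equal to $a$. A modulus is an increasing function $\phi:[0,+\infty)\to[0,+\infty]$ that vanishes only at $0$. The function $\varphi$ is uniformly quasiconvex with modulus $\phi$ on a convex set $C\subseteq\operatorname{dom}\varphi$ if for all $x,y\in C$ and $\lambda\in[0,1]$, $$\varphi(\lambda x+(1-\lambda)y)+\lambda(1-\lambda)\phi(\|x-y\|)\le\max\{\varphi(x),\varphi(y)\}.$$ HiPPA (high-order proximal-point algorithm) of order $p>1$: fix $\gamma_{\max}>\gamma_{\min}>0$ and $x^0\in C$; for $k=0,1,2,\dots$, while the stopping criteria do not hold, select $\gamma_k\in(\gamma_{\min},\gamma_{\max})$ and compute $$x^{k+1}\in\arg\min_{y\in C}\left(\varphi(y)+\frac{1}{p\gamma_k}\|x^k-y\|^p\right).$$ (Under the hypotheses of the claim these sets of minimizers are nonempty, and $\varphi$ has a unique minimizer $\overline{x}$ on $C$.)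
   Formalization: A negative ceiling (possible only when ε exceeds ‖x⁰−x̄‖) is read as 0 in all bounds; in (d) the log-log inequality is stated only for ε ≤ ‖x⁰−x̄‖, being false otherwise, and the displayed bound and inequality only for u₀ < 1, since at u₀ = 1 they contain log 0. *)

(* Defs.v *)
From HB Require Import structures.
From mathcomp Require Import all_boot all_order all_algebra.
From mathcomp Require Import all_classical all_reals all_analysis.
Set Implicit Arguments.
Unset Strict Implicit.
Unset Printing Implicit Defensive.
Import Order.TTheory GRing.Theory Num.Theory.
Import numFieldNormedType.Exports.
Local Open Scope classical_set_scope.
Local Open Scope ring_scope.

(* The norm `|v| that MathComp-Analysis puts on 'rV[R]_n is the sup norm; it
   induces the same topology, so [closed] and [lower_semicontinuous] can be
   used as they are, but the distances need the Euclidean norm. *)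
Definition enorm (R : realType) (n : nat) (v : 'rV[R]_n) : R :=
  Num.sqrt (\sum_(i < n) v ord0 i ^+ 2).

Definition edom (R : realType) (T : Type) (f : T -> \bar R) : set T :=
  [set x | (f x < +oo)%E].

Definition proper_fun (R : realType) (T : Type) (f : T -> \bar R) : Prop :=
  edom f !=set0.

Definition coercive_fun (R : realType) (n : nat) (f : 'rV[R]_n -> \bar R) : Prop :=
  forall A : R, exists M : R, forall x, M < enorm x -> (A%:E < f x)%E.

(* "Increasing" is read as nondecreasing: phi may equal +oo on a half-line. *)
Definition is_modulus (R : realType) (phi : R -> \bar R) : Prop :=
  [/\ forall s t, 0 <= s -> s <= t -> (phi s <= phi t)%E,
      forall t, 0 <= t -> (0 <= phi t)%E
    & forall t, 0 <= t -> (phi t = 0%E <-> t = 0)].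

Definition uniformly_quasiconvex (R : realType) (n : nat)
    (f : 'rV[R]_n -> \bar R) (phi : R -> \bar R) (C : set 'rV[R]_n) : Prop :=
  forall x y (lambda : R), C x -> C y -> 0 <= lambda -> lambda <= 1 ->
    (f (lambda *: x + (1 - lambda) *: y)%R
       + (lambda * (1 - lambda))%:E * phi (enorm (x - y)%R)
     <= maxe (f x) (f y))%E.

Definition argmin (R : realType) (T : Type) (C : set T) (f : T -> \bar R) : set T :=
  [set x | C x /\ forall y, C y -> (f x <= f y)%E].

Definition HiPPA (R : realType) (n : nat) (f : 'rV[R]_n -> \bar R)
    (C : set 'rV[R]_n) (p gmin gmax : R)
    (gamma : nat -> R) (x : nat -> 'rV[R]_n) : Prop :=
  C (x 0%N) /\
  forall k : nat, gmin < gamma k < gmax /\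
    argmin C (fun y => (f y + ((p * gamma k)^-1 * enorm (x k - y) `^ p)%:E)%E)
      (x k.+1).

(* N eps is the least k with ||xbar - x^k|| < eps, for every eps > 0; in
   particular every accuracy is reached. The value of N at eps <= 0 is
   unconstrained. *)
Definition iteration_count (R : realType) (n : nat) (x : nat -> 'rV[R]_n)
    (xbar : 'rV[R]_n) (N : R -> nat) : Prop :=
  forall eps : R, 0 < eps ->
    enorm (xbar - x (N eps)) < eps /\
    forall k : nat, (k < N eps)%N -> eps <= enorm (xbar - x k).

(* N <= ceil b, for a count N of iterations: a negative ceiling, which occurs
   only for tolerances already met by x^0, is read as zero iterations.
   When eps <= ||x^0 - xbar|| the truncation is immaterial. *)
Definition count_le_ceil (R : realType) (N : nat) (b : R) : Prop :=
  (N%:Z <= Num.max 0 (Num.ceil b))%R.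

Definition complexity (R : realType) (N : R -> nat) (h : R -> R) : Prop :=
  let F := (0 : R)^'+ in
  (fun e => (N e)%:R : R^o) =O_F (h : R -> R^o).

(* Main.v *)
Require Import Defs.
From HB Require Import structures.
From mathcomp Require Import all_boot all_order all_algebra.
From mathcomp Require Import all_classical all_reals all_analysis.
From mathcomp Require Import ring lra.
Set Implicit Arguments.
Unset Strict Implicit.
Unset Printing Implicit Defensive.
Import Order.TTheory GRing.Theory Num.Theory.
Import numFieldNormedType.Exports.
Local Open Scope classical_set_scope.
Local Open Scope ring_scope.

(* Write x, y for two consecutive iterates, D = |x - xbar|, d = |y - xbar|,
   s = |x - y| and e = <x - y, y - xbar>.  Comparing y with the points of the
   segment from y to xbar in the proximal problem, using uniform
   quasiconvexity, and letting the point tend to y, gives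
   gamma phi(d) <= s^(p-2) e (and phi(d) <= 0 if s = 0, since p > 1).
   Now D^2 = s^2 + 2 e + d^2 and e >= 0, so s, d <= D, while Cauchy-Schwarz
   gives both e <= s d and e <= D d - d^2.  Hence
     gamma phi(d) <= D^(p-1) d   and, for p >= 2,
     gamma phi(d) <= D^(p-2) (D d - d^2).
   The first inequality yields the linear rate (a) and the superlinear
   recursion d <= c D^alpha of (d); the second one yields (b) and
   (gamma rho + 1) d^(p-1) <= D^(p-1), which is stronger than what (c) needs as
   sigma <= p.  A rate turns into a bound on N(eps) because eps <= d_m holds at
   m = N(eps) - 1. *)

(** * The Euclidean inner product and the Cauchy-Schwarz inequality *)

Definition edot (R : realType) (n : nat) (u v : 'rV[R]_n) : R :=
  \sum_(i < n) u ord0 i * v ord0 i.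

Lemma enormE (R : realType) (n : nat) (u : 'rV[R]_n) :
  enorm u = Num.sqrt (edot u u).
Proof. by rewrite /enorm /edot; under eq_bigr do rewrite expr2. Qed.

Lemma edot_ge0 (R : realType) (n : nat) (u : 'rV[R]_n) : 0 <= edot u u.
Proof. by apply: sumr_ge0 => i _; rewrite -expr2 sqr_ge0. Qed.

Lemma enorm_ge0 (R : realType) (n : nat) (u : 'rV[R]_n) : 0 <= enorm u.
Proof. exact: sqrtr_ge0. Qed.

Lemma enorm_sqr (R : realType) (n : nat) (u : 'rV[R]_n) :
  enorm u ^+ 2 = edot u u.
Proof. by rewrite enormE sqr_sqrtr// edot_ge0. Qed.

Lemma edotDl (R : realType) (n : nat) (u v w : 'rV[R]_n) :
  edot (u + v) w = edot u w + edot v w.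
Proof.
by rewrite /edot -big_split; apply: eq_bigr => i _ /=; rewrite mxE mulrDl.
Qed.

Lemma edotDZ (R : realType) (n : nat) (u v : 'rV[R]_n) (t : R) :
  edot (u + t *: v) (u + t *: v) =
  edot u u + 2 * t * edot u v + t ^+ 2 * edot v v.
Proof.
rewrite /edot !mulr_sumr -!big_split /=; apply: eq_bigr => i _.
by rewrite !mxE; ring.
Qed.

Lemma enormB (R : realType) (n : nat) (u v : 'rV[R]_n) :
  enorm (u - v) = enorm (v - u).
Proof.
by congr Num.sqrt; apply: eq_bigr => i _; rewrite !mxE -sqrrN opprB.
Qed.

Lemma edot_le_enorm (R : realType) (n : nat) (u v : 'rV[R]_n) :
  edot u v <= enorm u * enorm v.
Proof.
have pos t := edot_ge0 (u + t *: v).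
have [U V] := (enorm_ge0 u, enorm_ge0 v).
have sqle : edot u v ^+ 2 <= edot u u * edot v v.
  (* The first value minimizes [|u + t v|^2] in [t]. The second serves [edot v v = 0]: the
     expression is then affine in [t] and equals [-1] there, which forces [edot u v = 0]. *)
  have := pos (- (edot u v / edot v v)).
  have := pos (- ((edot u u + 1) / (2 * edot u v))).
  rewrite !edotDZ; have [v0|v0] := eqVneq (edot v v) 0.
    rewrite v0 => + _; have [->|uv0] := eqVneq (edot u v) 0.
      by move=> _; rewrite expr0n mulr0 lexx.
    set e := (X in 0 <= X -> _); have -> : e = - 1 by rewrite /e; field.
    by rewrite oppr_ge0 ler10.
  move=> _ ; set e := (X in 0 <= X -> _).
  have -> : e = edot u u - edot u v ^+ 2 / edot v v by rewrite /e; field.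
  by rewrite subr_ge0 ler_pdivrMr// lt_neqAle eq_sym v0 edot_ge0.
rewrite (le_trans (ler_norm _))// -(@ler_pXn2r _ 2)// ?nnegrE ?mulr_ge0//.
by rewrite real_normK ?num_real// exprMn !enorm_sqr.
Qed.

Lemma enormZ (R : realType) (n : nat) (t : R) (u : 'rV[R]_n) :
  enorm (t *: u) = `|t| * enorm u.
Proof.
rewrite /enorm; under eq_bigr do rewrite mxE exprMn.
by rewrite -mulr_sumr sqrtrM ?sqr_ge0// sqrtr_sqr.
Qed.

Lemma enorm0 (R : realType) (n : nat) : enorm (0 : 'rV[R]_n) = 0.
Proof. by rewrite -(scale0r 0) enormZ normr0 mul0r. Qed.

Lemma enorm_eq0 (R : realType) (n : nat) (u : 'rV[R]_n) :
  enorm u = 0 -> u = 0.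
Proof.
move=> u0; have : \sum_(i < n) u ord0 i ^+ 2 = 0.
  by have := enorm_sqr u; rewrite u0 expr0n /= /edot => /esym.
move=> /psumr_eq0P u2; apply/rowP => i; rewrite mxE.
apply/eqP; rewrite -sqrf_eq0; apply/eqP/u2 => // j _; exact: sqr_ge0.
Qed.

(** Removes the square root, so that along a line the proximal term becomes a power of a quadratic
    polynomial. *)
Lemma powR_enorm (R : realType) (n : nat) (u : 'rV[R]_n) (p : R) :
  enorm u `^ p = edot u u `^ (p / 2).
Proof. by rewrite enormE -powR12_sqrt ?edot_ge0// -powRrM mulrC. Qed.

(** * First-order condition along the segment to the minimizer *)

Lemma derive_ge_chord (R : realType) (g : R -> R) (b g' : R) :
  is_derive (0 : R) (1 : R) g g' ->
  (forall t, 0 < t -> t < 1 -> t * (1 - t) * b <= g t - g 0) -> b <= g'.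
Proof.
move=> [dg <-] chord.
(* The limit of the difference quotient is restricted to the right of 0, where the chord bound
   divided by [h] applies. *)
have quot : h^-1 *: (g (h *: 1 + 0) - g 0) @[h --> (0:R)^'+] --> 'D_1 g 0.
  apply: cvg_trans dg; apply: cvg_app; apply: within_subset => t /=.
  by move=> /gt_eqF ->.
have line : (1 - h) * b @[h --> (0:R)^'+] --> (1 - 0) * b.
  apply: cvg_at_right_filter; apply: cvgM; last exact: cvg_cst.
  by apply: cvgB; [exact: cvg_cst|exact: cvg_id].
rewrite -[b]mul1r -[X in X * b]subr0.
apply: (ler_cvg_to line quot).
near=> h.
have h0 : 0 < h by near: h; exact: nbhs_right_gt.
have h1 : h < 1 by near: h; exact: nbhs_right_lt.
rewrite [h *: 1]mulr1 addr0 /GRing.scale /= ler_pdivlMl//.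
by rewrite mulrA; exact: chord.
Unshelve. all: by end_near. Qed.

(** For [S = |a|^2], [w = <a, b>], [T = |b|^2] and [r = p / 2] this differentiates [|a + t b|^p] at
    [t = 0]; positivity of [S] keeps the base of the power away from 0. *)
Lemma is_derive_powR_quad (R : realType) (S w T r : R) : 0 < S ->
  is_derive (0 : R) (1 : R) (fun t : R => (S + 2 * t * w + t ^+ 2 * T) `^ r)
    (r * S `^ (r - 1) * (2 * w)).
Proof.
move=> S0.
set q := fun t : R => S + 2 * t * w + t ^+ 2 * T.
have q0 : q 0 = S by rewrite /q !(mulr0, mul0r, addr0, expr0n).
have dq : is_derive (0 : R) (1 : R) q (2 * w).
  rewrite /q; apply: is_derive_eq.
  by rewrite /GRing.scale /=; ring.
have dp : is_derive (q 0) (1 : R) (@powR R ^~ r) (r * S `^ (r - 1)).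
  by rewrite q0; exact: is_derive1_powR.
have := @is_derive1_comp _ (@powR R ^~ r) q 0 _ _ dp dq.
by [].
Qed.

(** The chord inequality is divided by [t] and [t] tends to 0. For [v] nonzero the right-hand side
    has derivative [g^-1 |v|^(p-2) <v, w>]; for [v = 0] it is of order [t^p] with [p > 1] and
    contributes nothing. *)
Lemma prox_growth_direction (R : realType) (n : nat) (v w : 'rV[R]_n)
    (p g a : R) :
  1 < p -> 0 < g ->
  (forall t, 0 < t -> t < 1 ->
     t * (1 - t) * a <= (p * g)^-1 * (enorm (v + t *: w) `^ p - enorm v `^ p)) ->
  if enorm v == 0 then a <= 0
  else g * a <= enorm v `^ (p - 2) * edot v w.
Proof.
move=> p1 g0 chord.
have p0 : 0 < p by lra.
have pg0 : 0 < p * g by rewrite mulr_gt0.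
have [v0|v0] := eqVneq (enorm v) 0; last first.
  have S0 : 0 < edot v v.
    by rewrite -enorm_sqr exprn_gt0// lt_neqAle eq_sym v0 enorm_ge0.
  have der := is_derive_powR_quad (edot v w) (edot w w) (p / 2) S0.
  have := derive_ge_chord (b := p * g * a) der.
  have -> : edot v v `^ (p / 2 - 1) = enorm v `^ (p - 2).
    by rewrite powR_enorm; congr (_ `^ _); field.
  move=> H; rewrite -(@ler_pM2l _ p)// mulrA.
  rewrite [leRHS](_ : _ = p / 2 * enorm v `^ (p - 2) * (2 * edot v w)); last by field.
  apply: H => t t0 t1.
  rewrite !(mulr0, mul0r, addr0, expr0n) -!powR_enorm -edotDZ -powR_enorm.
  have := chord t t0 t1; rewrite ler_pdivlMl// => H.
  by rewrite [leLHS]mulrCA.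
move/enorm_eq0: v0 chord => -> chord.
have lhs : (1 - h) * a @[h --> (0:R)^'+] --> (1 - 0) * a.
  apply: cvg_at_right_filter; apply: cvgM; last exact: cvg_cst.
  by apply: cvgB; [exact: cvg_cst|exact: cvg_id].
have rhs : (p * g)^-1 * enorm w `^ p * h `^ (p - 1) @[h --> (0:R)^'+] -->
    (p * g)^-1 * enorm w `^ p * 0.
  by apply: cvgM; [exact: cvg_cst|apply: powR_cvg0; lra].
rewrite -[a]mul1r -[X in X * a]subr0.
rewrite -[leRHS](mulr0 ((p * g)^-1 * enorm w `^ p)).
apply: (ler_cvg_to lhs rhs).
near=> h.
have h0 : 0 < h by near: h; exact: nbhs_right_gt.
have h1 : h < 1 by near: h; exact: nbhs_right_lt.
rewrite -(@ler_pM2l _ h)// mulrA (le_trans (chord h h0 h1))//.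
rewrite add0r enorm0 powR0 ?gt_eqF// subr0 enormZ gtr0_norm//.
rewrite powRM ?enorm_ge0 ?(ltW h0)//.
by rewrite -(mulr_powRB1 (ltW h0) p0); rewrite le_eqVlt; apply/orP; left; apply/eqP; ring.
Unshelve. all: by end_near. Qed.

(** The competitor is [t z + (1 - t) y]: quasiconvexity puts its value at least [t (1 - t) a] below
    [f y], and minimality of [y] makes the proximal term pay for this gain. The real [a] stands in
    for [phi], which may be infinite. *)
Lemma prox_chord (R : realType) (n : nat) (f : 'rV[R]_n -> \bar R)
    (phi : R -> \bar R) (C : set 'rV[R]_n) (k a : R) (p : R) (x y z : 'rV[R]_n) :
  (forall u, f u <> -oo%E) ->
  convex_set (C : set (convex_lmodType 'rV[R]_n)) -> C `<=` edom f ->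
  uniformly_quasiconvex f phi C ->
  argmin C (fun u => (f u + (k * enorm (x - u) `^ p)%:E)%E) y ->
  C z -> (f z <= f y)%E -> (a%:E <= phi (enorm (z - y)))%E ->
  forall t, 0 < t -> t < 1 ->
    t * (1 - t) * a <=
    k * (enorm ((x - y) + t *: (y - z)) `^ p - enorm (x - y) `^ p).
Proof.
move=> fNy Cconv Cdom fuqc [Cy ymin] Cz fzy aphi t t0 t1.
set u := t *: z + (1 - t) *: y.
have Cu : C u.
  have := @Cconv z y (Itv01 (ltW t0) (ltW t1)).
  by rewrite !inE => /(_ Cz Cy).
have fin v : C v -> f v \is a fin_num.
  move=> /Cdom /= fv; rewrite fin_numE (lt_eqF fv) andbT.
  by apply/eqP; exact: fNy.
have := fuqc z y t Cz Cy (ltW t0) (ltW t1); rewrite -/u max_r// => uqc.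
have := ymin u Cu.
have -> : x - u = (x - y) + t *: (y - z).
  by apply/rowP => i; rewrite !mxE; ring.
move: uqc; rewrite -(fineK (fin _ Cu)) -(fineK (fin _ Cy)) -!EFinD lee_fin => uqc.
have {}uqc : fine (f u) + t * (1 - t) * a <= fine (f y).
  rewrite -lee_fin (le_trans _ uqc)// EFinD leeD2l// EFinM lee_wpmul2l//.
  by rewrite lee_fin mulr_ge0 ?subr_ge0 // ltW.
rewrite [X in _ -> _ <= X]mulrBr => ymin'.
suff combine A B F G H : G + H <= F -> F + B <= G + A -> H <= A - B :> R.
  exact: combine uqc ymin'.
by clear => *; lra.
Qed.

(** The strict decrease serves (a), where growth of [phi] is known only on [[0, 1)] while an iterate
    may lie on the unit sphere. *)
Lemma prox_step (R : realType) (n : nat) (f : 'rV[R]_n -> \bar R)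
    (phi : R -> \bar R) (C : set 'rV[R]_n) (p g : R) (x y z : 'rV[R]_n) :
  (forall u, f u <> -oo%E) ->
  convex_set (C : set (convex_lmodType 'rV[R]_n)) -> C `<=` edom f ->
  is_modulus phi -> uniformly_quasiconvex f phi C -> 1 < p -> 0 < g ->
  argmin C (fun u => (f u + ((p * g)^-1 * enorm (x - u) `^ p)%:E)%E) y ->
  C z -> (f z <= f y)%E ->
  let D := enorm (x - z) in let d := enorm (y - z) in
  [/\ 0 < d -> d < D,
      forall a, (a%:E <= phi d)%E -> g * a <= D `^ (p - 1) * d
    & 2 <= p -> forall a, (a%:E <= phi d)%E ->
        g * a <= D `^ (p - 2) * (D * d - d ^+ 2)].
Proof.
move=> fNy Cconv Cdom [_ phi_ge0 phi_eq0] fuqc p1 g0 ymin Cz fzy D d.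
pose v := x - y; pose w := y - z; pose s := enorm v.
have dirP a : (a%:E <= phi d)%E ->
    if s == 0 then a <= 0 else g * a <= s `^ (p - 2) * edot v w.
  move=> aphi; apply: prox_growth_direction => // t t0 t1.
  by apply: (prox_chord fNy Cconv Cdom fuqc ymin) => //; rewrite enormB.
have [D0 d0 s0] : [/\ 0 <= D, 0 <= d & 0 <= s] by rewrite !enorm_ge0.
have vw0 : 0 <= edot v w.
  (* With [a = 0] the direction inequality reads [0 <= s^(p-2) <v, w>]. *)
  have := dirP 0 (phi_ge0 _ d0); have [sz _|sn0] := eqVneq s 0.
    have /enorm_eq0 -> : enorm v = 0 by [].
    by rewrite /edot big1// => i _; rewrite mxE mul0r.
  rewrite mulr0 pmulr_rge0// powR_gt0// lt_neqAle eq_sym sn0 //.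
have Dsq : D ^+ 2 = s ^+ 2 + 2 * edot v w + d ^+ 2.
  have := edotDZ v w 1; rewrite scale1r mulr1 expr1n mul1r -!enorm_sqr.
  by have -> : v + w = x - z by rewrite /v /w addrA subrK.
have vw_s : edot v w <= s * d by exact: edot_le_enorm.
have vw_D : edot v w <= D * d - d ^+ 2.
  rewrite lerBrDr enorm_sqr -edotDl.
  have -> : v + w = x - z by rewrite /v /w addrA subrK.
  exact: edot_le_enorm.
move: (edot v w) dirP vw0 Dsq vw_s vw_D => e dirP vw0 Dsq vw_s vw_D.
clearbody D d s.
have sD : s <= D.
  by rewrite -(@ler_pXn2r _ 2)// Dsq -addrA lerDl addr_ge0 ?sqr_ge0 ?mulr_ge0.
have dD : d <= D.
  by rewrite -(@ler_pXn2r _ 2)// Dsq lerDr addr_ge0 ?sqr_ge0 ?mulr_ge0.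
split.
(* Equality [d = D] would force [s = 0]; then every real [a] below [phi d] is nonpositive, although
   [phi d > 0]. *)
- move=> d_gt0; rewrite lt_neqAle dD andbT; apply/eqP => dDeq.
  have sz : s = 0.
    apply/eqP; rewrite -sqrf_eq0 eq_le sqr_ge0 andbT.
    by move: Dsq vw0; rewrite dDeq; lra.
  have phi_pos : (0 < phi d)%E.
    rewrite lt_neqAle phi_ge0// andbT; apply/eqP => /esym /(phi_eq0 _ d0) dz.
    by rewrite dz ltxx in d_gt0.
  have : exists2 a : R, 0 < a & (a%:E <= phi d)%E.
    case: (phi d) phi_pos => [r|_|//]; last by exists 1; rewrite ?leey.
    by rewrite lte_fin => r0; exists r.
  by move=> [a a0 /dirP]; rewrite sz eqxx leNgt a0.
- move=> a /dirP; have [sz a0|sn0 ga] := eqVneq s 0.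
    by rewrite (@le_trans _ _ 0)// ?mulr_ge0 ?powR_ge0// pmulr_rle0.
  have s_gt0 : 0 < s by rewrite lt_neqAle eq_sym sn0.
  (* As [p - 2] may be negative, the factor [s] from [e <= s d] is absorbed first; only [s^(p-1)] is
     compared with [D^(p-1)]. *)
  rewrite (le_trans ga)// (@le_trans _ _ (s `^ (p - 2) * (s * d)))//.
    by rewrite ler_wpM2l ?powR_ge0.
  rewrite mulrA ler_wpM2r// mulrC.
  have -> : p - 2 = (p - 1) - 1 by lra.
  rewrite mulr_powRB1//; last by lra.
  by rewrite ge0_ler_powR// ?nnegrE//; lra.
- move=> p2 a /dirP; have [sz a0|sn0 ga] := eqVneq s 0.
    rewrite (@le_trans _ _ 0)// ?mulr_ge0 ?powR_ge0// ?pmulr_rle0//.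
    by rewrite subr_ge0 expr2 ler_wpM2r.
  rewrite (le_trans ga)// ler_pM ?powR_ge0//.
  by rewrite ge0_ler_powR// ?nnegrE//; lra.
Qed.

(** * From error bounds to iteration counts and asymptotic complexity *)

Lemma iteration_count_bound (R : realType) (n : nat) (x : nat -> 'rV[R]_n)
    (xbar : 'rV[R]_n) (b : R -> R) :
  (forall eps m, 0 < eps -> eps <= enorm (x m - xbar) -> m%:R <= b eps) ->
  exists N : R -> nat, iteration_count x xbar N /\
    forall eps, 0 < eps -> N eps = 0%N \/ (N eps)%:R <= 1 + b eps.
Proof.
move=> xb.
(* An index beyond [b eps] cannot have error at least [eps], so every accuracy is reached and a
   least index exists. *)
have reach eps : 0 < eps -> exists k, enorm (xbar - x k) < eps.
  move=> eps0; exists (Num.truncn (b eps)).+1; rewrite ltNge; apply/negP.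
  rewrite enormB => /(xb _ _ eps0); rewrite leNgt => /negP; apply.
  exact: truncnS_gt.
pose N eps := if pselect (0 < eps) is left eps0 then ex_minn (reach eps eps0)
  else 0%N.
have NP : iteration_count x xbar N.
  move=> eps eps0; rewrite /N; case: pselect => // eps0'.
  case: ex_minnP => k kP kmin; split=> // m mk; rewrite leNgt.
  by apply/negP => /kmin; rewrite leqNgt mk.
exists N; split=> // eps eps0; have [_] := NP eps eps0.
(* A positive count has a preceding iterate with error at least [eps], whence the summand 1; a zero
   count has none and is kept apart. *)
case: (N eps) => [|m] minN; [by left|right].
by rewrite -natr1 addrC lerD2l xb// enormB minN.
Qed.

Lemma count_le_ceilP (R : realType) (N : nat) (b : R) :
  N = 0%N \/ N%:R <= b -> count_le_ceil N b.
Proof.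
rewrite /count_le_ceil le_max; move=> [->|Nb]; first by rewrite lexx.
by apply/orP; right; rewrite -(ler_int R) (le_trans Nb)// ceil_ge.
Qed.

Lemma complexityP (R : realType) (N : R -> nat) (h : R -> R) (A B : R) :
  0 <= B -> h e @[e --> 0^'+] --> +oo ->
  (\forall e \near 0^'+, N e = 0%N \/ (N e)%:R <= A + B * h e) ->
  complexity N h.
Proof.
move=> B0 hoo Nh; rewrite /complexity /=; apply/eqO_exP.
(* Where [h e >= 1], [A + B h] is at most [(|A| + B) h]; the extra 1 makes the constant positive. *)
exists (`|A| + B + 1); first by rewrite ltr_pwDr// addr_ge0.
near=> e.
have h1 : 1 <= h e by near: e; move/cvgryPge: hoo; exact.
have : N e = 0%N \/ (N e)%:R <= A + B * h e by near: e.
rewrite normr_nat (ger0_norm (le_trans ler01 h1)) => -[->|Ne].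
  by rewrite mulr_ge0 ?addr_ge0 ?(le_trans ler01 h1).
rewrite (le_trans Ne)//; have := ler_norm A; have := normr_ge0 A.
nra.
Unshelve. all: by end_near. Qed.

(** * Logarithms near 0, and counts from linear and superlinear recursions *)

Lemma cvg_lnV_at_right (R : realType) : ln e^-1 @[e --> (0:R)^'+] --> +oo.
Proof.
apply: (@cvg_trans _ (- ln e @[e --> (0:R)^'+])).
  apply: near_eq_cvg; near=> e; rewrite lnV// posrE.
  by near: e; exact: nbhs_right_gt.
exact/cvgNry/lnNy.
Unshelve. all: by end_near. Qed.

Lemma cvg_lny (R : realType) : ln x @[x --> +oo] --> (+oo : set_system R).
Proof.
apply/cvgryPge => A; near=> x.
have x0 : expR A <= x by near: x; exact: nbhs_pinfty_ge.
rewrite -(expRK A) ler_ln ?posrE ?expR_gt0//.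
Unshelve. all: by end_near. Qed.

(** Iteration gives [eps * expR (L m) <= d 0], and logarithms finish. Writing the rate as [expR L]
    makes [L] the denominator of the bound. *)
Lemma linear_count (R : realType) (d : nat -> R) (L eps : R) (m : nat) :
  0 < L -> (forall k, d k.+1 * expR L <= d k) -> 0 < eps -> eps <= d m ->
  m%:R <= (ln eps^-1 + ln (d 0%N)) / L.
Proof.
move=> L0 dS eps0 epsd.
have dm : d m * expR (L * m%:R) <= d 0%N.
  elim: m {epsd} => [|m IH]; first by rewrite mulr0 expR0 mulr1.
  rewrite -natr1 mulrDr mulr1 addrC expRD mulrA (le_trans _ IH)//.
  by rewrite ler_wpM2r ?expR_ge0.
have {}dm : eps * expR (L * m%:R) <= d 0%N.
  by rewrite (le_trans _ dm)// ler_wpM2r ?expR_ge0.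
have P0 : 0 < eps * expR (L * m%:R) by rewrite mulr_gt0 ?expR_gt0.
rewrite ler_pdivlMr// lnV ?posrE// addrC lerBrDl mulrC.
have := dm; rewrite -ler_ln ?posrE// ?(lt_le_trans P0)//.
by rewrite lnM ?posrE ?expR_gt0// expRK.
Qed.

(** An [r]-th root is taken: [expR (ln K / r)] is [K^(1/r)], in the form used by [linear_count]. *)
Lemma powR_contraction (R : realType) (K r d D : R) :
  0 < K -> 0 < r -> 0 <= d -> 0 <= D -> K * d `^ r <= D `^ r ->
  d * expR (ln K / r) <= D.
Proof.
move=> K0 r0 d0 D0 le_r; rewrite leNgt; apply/negP => /(gt0_ltr_powR r0).
rewrite !nnegrE mulr_ge0 ?expR_ge0// => /(_ D0 isT).
rewrite powRM ?expR_ge0// [expR _ `^ r]/powR gt_eqF ?expR_gt0// expRK.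
by rewrite mulrCA mulfV ?gt_eqF// mulr1 lnK ?posrE// mulrC ltNge le_r.
Qed.

(** Since [be + 1 = be * al], the rescaled errors [u_k = c^be d_k] satisfy [u_(k+1) <= u_k^al],
    hence [u_m <= u0^(al^m)]; two logarithms isolate [m]. *)
Lemma superlinear_count (R : realType) (d : nat -> R) (c al eps : R) (m : nat) :
  let be := (al - 1)^-1 in let u0 := c `^ be * d 0%N in
  0 < c -> 1 < al -> (forall k, 0 <= d k) ->
  (forall k, d k.+1 <= c * d k `^ al) -> u0 < 1 -> 0 < eps -> eps <= d m ->
  m%:R <= (ln (ln (c `^ (- be) * eps^-1)) - ln (ln u0^-1)) / ln al.
Proof.
move=> be u0 c0 al1 d0 dS u01 eps0 epsd.
have al0 : 0 < al by lra.
have cbe : 0 < c `^ be by rewrite powR_gt0.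
have u0_ge0 : 0 <= u0 by rewrite mulr_ge0// ltW.
have um : c `^ be * d m <= u0 `^ (al ^+ m).
  elim: m {epsd} => [|m IH]; first by rewrite expr0 powRr1.
  apply: (@le_trans _ _ ((c `^ be * d m) `^ al)).
    rewrite powRM ?(ltW cbe)// -powRrM.
    apply: (@le_trans _ _ (c `^ be * (c * d m `^ al))).
      by rewrite ler_wpM2l// ltW.
    rewrite mulrA ler_wpM2r ?powR_ge0//.
    rewrite -[X in _ * X](powRr1 (ltW c0)) -powRD ?(gt_eqF c0) ?implybT//.
    rewrite le_eqVlt; apply/orP; left; apply/eqP; congr (_ `^ _).
    by rewrite /be; field; lra.
  by rewrite exprSr powRrM ge0_ler_powR// ?(ltW al0)// nnegrE ?powR_ge0// mulr_ge0// ltW.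
have e'0 : 0 < c `^ be * eps by rewrite mulr_gt0.
have {}um : c `^ be * eps <= u0 `^ (al ^+ m).
  by rewrite (le_trans _ um)// ler_pM2l.
(* [ln] is 0 on nonpositive reals, so positivity of [u0] and of [ln u0^-1] has to precede the two
   logarithms. *)
have u0_gt0 : 0 < u0.
  rewrite lt_neqAle u0_ge0 andbT eq_sym; apply/eqP => u00.
  by move: um; rewrite u00 powR0 ?gt_eqF ?exprn_gt0// leNgt e'0.
have lu0 : 0 < ln u0^-1 by rewrite ln_gt0// invf_gt1.
have -> : c `^ (- be) * eps^-1 = (c `^ be * eps)^-1 by rewrite powRN invfM.
have lnle : al ^+ m * ln u0^-1 <= ln (c `^ be * eps)^-1.
  rewrite !lnV ?posrE// mulrN lerN2 -ln_powR ler_ln ?posrE//.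
  exact: lt_le_trans um.
have pos : 0 < al ^+ m * ln u0^-1 by rewrite mulr_gt0// exprn_gt0.
rewrite ler_pdivlMr ?ln_gt0// lerBrDr mulr_natl -lnXn// -lnM ?posrE ?exprn_gt0//.
by rewrite ler_ln// posrE (lt_le_trans pos).
Qed.

Lemma cvg_lnlnV_at_right (R : realType) :
  ln (ln e^-1) @[e --> (0:R)^'+] --> +oo.
Proof. exact: cvg_comp (@cvg_lnV_at_right R) (@cvg_lny R). Qed.

(** Once [ln e^-1] exceeds [1 + |ln a|], the factor [a] at most doubles the inner logarithm and
    costs [ln 2] outside. *)
Lemma lnlnV_scale (R : realType) (a : R) : 0 < a ->
  \forall e \near 0^'+, ln (ln (a * e^-1)) <= ln 2 + ln (ln e^-1).
Proof.
move=> a0; near=> e.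
have e0 : 0 < e by near: e; exact: nbhs_right_gt.
have le1 : 1 + `|ln a| <= ln e^-1.
  by near: e; move/cvgryPge: (@cvg_lnV_at_right R); exact.
have := ler_norm (ln a); have := ler_norm (- ln a); rewrite normrN => na pa.
rewrite lnM ?posrE ?invr_gt0// -[ln 2 + _]lnM ?posrE//; last by lra.
by rewrite ler_ln ?posrE; lra.
Unshelve. all: by end_near. Qed.

(** * Complexity of linearly and superlinearly converging iterates *)

Lemma linear_complexity (R : realType) (n : nat) (x : nat -> 'rV[R]_n)
    (xbar : 'rV[R]_n) (L : R) : 0 < L ->
  (forall k, enorm (x k.+1 - xbar) * expR L <= enorm (x k - xbar)) ->
  exists N : R -> nat, [/\ iteration_count x xbar N,
    forall eps, 0 < eps -> count_le_ceil (N eps)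
      (1 + (ln eps^-1 + ln (enorm (x 0%N - xbar))) / L)
    & complexity N (fun eps => ln eps^-1)].
Proof.
move=> L0 xS.
pose b eps := (ln eps^-1 + ln (enorm (x 0%N - xbar))) / L.
have [eps m eps0|N [NP Nb]] := @iteration_count_bound _ _ x xbar b.
  exact: (@linear_count _ (fun k => enorm (x k - xbar))).
exists N; split=> // [eps eps0|]; first by apply: count_le_ceilP; exact: Nb.
apply: (@complexityP _ _ _ (1 + ln (enorm (x 0%N - xbar)) / L) L^-1).
- by rewrite invr_ge0 ltW.
- exact: cvg_lnV_at_right.
near=> e; have e0 : 0 < e by near: e; exact: nbhs_right_gt.
have [->|Ne] := Nb e e0; [by left|right].
rewrite (le_trans Ne)// le_eqVlt; apply/orP; left; apply/eqP.
by rewrite /b; ring.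
Unshelve. all: by end_near. Qed.

(** The explicit bound is for [u0 < 1], but the complexity is also claimed at [u0 = 1]; the strict
    first step is assumed for that boundary case. *)
Lemma superlinear_complexity (R : realType) (n : nat) (x : nat -> 'rV[R]_n)
    (xbar : 'rV[R]_n) (c al : R) :
  let be := (al - 1)^-1 in let u0 := c `^ be * enorm (x 0%N - xbar) in
  0 < c -> 1 < al -> u0 <= 1 ->
  (forall k, enorm (x k.+1 - xbar) <= c * enorm (x k - xbar) `^ al) ->
  (0 < enorm (x 1%N - xbar) ->
     enorm (x 1%N - xbar) < c * enorm (x 0%N - xbar) `^ al) ->
  exists N : R -> nat, [/\ iteration_count x xbar N,
    u0 < 1 -> forall eps, 0 < eps -> count_le_ceil (N eps)
      (1 + (ln (ln (c `^ (- be) * eps^-1)) - ln (ln u0^-1)) / ln al)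
    & complexity N (fun eps => ln (ln eps^-1))].
Proof.
move=> be u0 c0 al1 u0_le1 xS xS0.
have al0 : 0 < al by lra.
pose d k := enorm (x k - xbar).
have d_ge0 k : 0 <= d k by exact: enorm_ge0.
pose b u eps := (ln (ln (c `^ (- be) * eps^-1)) - ln (ln u^-1)) / ln al.
have lnal : 0 < ln al by rewrite ln_gt0.
have bP u : exists A, \forall e \near 0^'+, b u e <= A + (ln al)^-1 * ln (ln e^-1).
  exists ((ln 2 - ln (ln u^-1)) / ln al).
  near=> e; rewrite /b [(ln al)^-1 * _]mulrC -mulrDl ler_pM2r ?invr_gt0//.
  rewrite addrAC lerD2r; near: e; apply: lnlnV_scale.
  by rewrite powR_gt0.
have [u01|u0_eq1] := ltP u0 1.
  have [eps m eps0|N [NP Nb]] := @iteration_count_bound _ _ x xbar (b u0).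
    exact: (@superlinear_count _ d).
  exists N; split=> // [_ eps eps0|]; first by apply: count_le_ceilP; exact: Nb.
  have [A AP] := bP u0.
  apply: (@complexityP _ _ _ (1 + A) (ln al)^-1).
  - by rewrite invr_ge0 ltW.
  - exact: cvg_lnlnV_at_right.
  near=> e; have e0 : 0 < e by near: e; exact: nbhs_right_gt.
  have [->|Ne] := Nb e e0; [by left|right].
  by rewrite (le_trans Ne)// -addrA lerD2l; near: e.
(* At u0 = 1, gamma_0 > gmin makes the first step strict, so the iterates from
   x 1 on satisfy the strict hypothesis. *)
pose u1 := c `^ be * d 1%N.
have u11 : u1 < 1.
  have [d10|] := ltP 0 (d 1%N); last first.
    by move=> d1; rewrite (@le_lt_trans _ _ 0)// pmulr_rle0// powR_gt0.
  apply: (@lt_le_trans _ _ (c `^ be * (c * d 0%N `^ al))).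
    by rewrite ltr_pM2l ?powR_gt0//; exact: xS0.
  have -> : c `^ be * (c * d 0%N `^ al) = u0 `^ al.
    rewrite /u0 -/(d 0%N) [RHS]powRM ?powR_ge0// -powRrM mulrA; congr (_ * _).
    rewrite -[X in _ * X](powRr1 (ltW c0)) -powRD ?(gt_eqF c0) ?implybT//.
    by congr (_ `^ _); rewrite /be; field; lra.
  have u0_ge0 : 0 <= u0 by rewrite mulr_ge0 ?powR_ge0 ?d_ge0.
  have := ge0_ler_powR (ltW al0) u0_ge0 ler01 u0_le1.
  by rewrite powR1.
(* The recursion is counted from [x 1], which adds 1; the maximum with 0 keeps the bound nonnegative
   for [m = 0]. *)
have [eps m eps0|N [NP Nb]] :=
    @iteration_count_bound _ _ x xbar (fun e => 1 + Num.max 0 (b u1 e)).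
  case: m => [|m] epsd; first by rewrite addr_ge0// le_max lexx.
  rewrite -natr1 addrC lerD2l le_max; apply/orP; right.
  exact: (@superlinear_count _ (fun k => d k.+1) c al eps m c0 al1
    (fun k => d_ge0 k.+1) (fun k => xS k.+1) u11 eps0 epsd).
exists N; split=> //.
have [A AP] := bP u1.
apply: (@complexityP _ _ _ (1 + (1 + `|A|)) (ln al)^-1).
- by rewrite invr_ge0 ltW.
- exact: cvg_lnlnV_at_right.
near=> e; have e0 : 0 < e by near: e; exact: nbhs_right_gt.
have [->|Ne] := Nb e e0; [by left|right].
have l0 : 0 <= ln (ln e^-1).
  by near: e; move/cvgryPge: (@cvg_lnlnV_at_right R); exact.
rewrite (le_trans Ne)// -!addrA !lerD2l ge_max addr_ge0 ?mulr_ge0 ?invr_ge0 ?(ltW lnal)//=.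
apply: (@le_trans _ _ (A + (ln al)^-1 * ln (ln e^-1))); first by near: e.
by rewrite lerD2r ler_norm.
Unshelve. all: by end_near. Qed.

(** * From growth of the modulus to contraction of the distances *)

Lemma growth_contraction (R : realType) (g rho q d D e : R) :
  1 < q -> 0 <= d -> 0 <= D ->
  g * (rho * d `^ q) <= D `^ e * d -> g * rho * d `^ (q - 1) <= D `^ e.
Proof.
move=> q1 d0 D0; have [->|dn0] := eqVneq d 0.
  by rewrite (@powR0 _ (q - 1)) ?mulr0 ?powR_ge0//; apply/eqP; lra.
have d_gt0 : 0 < d by rewrite lt_neqAle eq_sym dn0.
rewrite -(@mulr_powRB1 _ d q)//; last by lra.
by rewrite (mulrC d) !mulrA ler_pM2r.
Qed.

Lemma quadratic_contraction (R : realType) (k d D : R) :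
  0 <= d -> 0 <= D -> k * d ^+ 2 <= D * d - d ^+ 2 -> d * (1 + k) <= D.
Proof.
move=> d0 D0; have [-> _|dn0 H] := eqVneq d 0; first by rewrite mul0r.
have d_gt0 : 0 < d by rewrite lt_neqAle eq_sym dn0.
by rewrite -(ler_pM2r d_gt0); nra.
Qed.

(** With [u = d^(p-2)] and [U = D^(p-2)], cancelling [d] leaves [k d u <= U (D - d)]; adding
    [d u <= d U] gives [(k + 1) d u <= U D]. *)
Lemma power_contraction (R : realType) (k p d D : R) :
  2 <= p -> 0 <= d -> d <= D ->
  k * d `^ p <= D `^ (p - 2) * (D * d - d ^+ 2) ->
  (k + 1) * d `^ (p - 1) <= D `^ (p - 1).
Proof.
move=> p2 d0 dD; have [->|dn0] := eqVneq d 0.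
  by rewrite (@powR0 _ (p - 1)) ?mulr0 ?powR_ge0//; apply/eqP; lra.
have d_gt0 : 0 < d by rewrite lt_neqAle eq_sym dn0.
have D0 := le_trans d0 dD.
have split1 y : 0 <= y -> y `^ (p - 1) = y * y `^ (p - 2).
  by move=> y0; rewrite -(@mulr_powRB1 _ y (p - 1))//; [congr (_ * _ `^ _)|]; lra.
rewrite -(@mulr_powRB1 _ d p)//; last by lra.
rewrite !split1//.
have dDp : d `^ (p - 2) <= D `^ (p - 2) by rewrite ge0_ler_powR ?nnegrE//; lra.
move: (d `^ (p - 2)) (D `^ (p - 2)) dDp => u U uU H.
have {}H : k * (d * u) <= U * (D - d).
  by rewrite -(ler_pM2l d_gt0); lra.
have : d * u <= d * U by rewrite ler_pM2l.
lra.
Qed.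

(** * The four convergence rates *)

Theorem theorem4p13 (R : realType) (n : nat)
  (f : 'rV[R]_n -> \bar R) (phi : R -> \bar R) (C : set 'rV[R]_n)
  (p gmin gmax : R) (gamma : nat -> R) (x : nat -> 'rV[R]_n)
  (xbar : 'rV[R]_n)
  (f_notNy : forall y, f y <> -oo%E)
  (f_proper : proper_fun f)
  (f_lsc : lower_semicontinuous f)
  (f_coercive : coercive_fun f)
  (C_neq0 : C !=set0)
  (C_closed : closed C)
  (C_convex : convex_set (C : set (convex_lmodType 'rV[R]_n)))
  (C_dom : C `<=` edom f)
  (phi_modulus : is_modulus phi)
  (f_uqc : uniformly_quasiconvex f phi C)
  (p_gt1 : 1 < p)
  (gmin_gt0 : 0 < gmin)
  (gmin_lt_gmax : gmin < gmax)
  (x_HiPPA : HiPPA f C p gmin gmax gamma x)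
  (xbar_argmin : argmin C f = [set xbar]) :
  let d0 := enorm (x 0%N - xbar) in
  [/\ (* (a) *)
      forall q rho : R, 1 < q -> q < 2 -> 0 < rho ->
        (forall t : R, 0 <= t -> t < 1 -> ((rho * t `^ q)%:E <= phi t)%E) ->
        q <= p -> p < 2 -> rho^-1 < gmin ->
        (forall k : nat, enorm (x k - xbar) <= 1) ->
        exists N : R -> nat,
          [/\ iteration_count x xbar N,
              forall eps : R, 0 < eps -> eps < 1 ->
                count_le_ceil (N eps)
                  (1 + (p - 1) * ((ln eps^-1 + ln d0) / ln (rho * gmin)))
            & complexity N (fun eps => ln eps^-1)],
      (* (b) *)
      forall rho : R, 0 < rho ->
        (forall t : R, 0 <= t -> ((rho * t ^+ 2)%:E <= phi t)%E) ->
        p = 2 ->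
        exists N : R -> nat,
          [/\ iteration_count x xbar N,
              forall eps : R, 0 < eps ->
                count_le_ceil (N eps)
                  (1 + (ln eps^-1 + ln d0) / ln (1 + rho * gmin))
            & complexity N (fun eps => ln eps^-1)],
      (* (c) *)
      forall rho : R, 2 < p -> 0 < rho ->
        (forall t : R, 0 <= t -> ((rho * t `^ p)%:E <= phi t)%E) ->
        rho^-1 < gmin ->
        let sigma := 2^-1 `^ ((3 * p - 2) / 2) in
        exists N : R -> nat,
          [/\ iteration_count x xbar N,
              forall eps : R, 0 < eps ->
                count_le_ceil (N eps)
                  (1 + (ln eps^-1 + ln d0)
                       / ((p - 1)^-1 * (ln (p * gmin * rho + sigma) - ln p)))
            & complexity N (fun eps => ln eps^-1)]
    & (* (d) *)
      forall q rho : R, 2 <= q -> 0 < rho ->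
        (forall t : R, 0 <= t -> ((rho * t `^ q)%:E <= phi t)%E) ->
        q < p ->
        let c := (gmin * rho) `^ (- 1 / (q - 1)) in
        let alpha := (p - 1) / (q - 1) in
        let u0 := c `^ ((alpha - 1)^-1) * d0 in
        d0 <= c `^ (- ((q - 1) / (p - q))) ->
        exists N : R -> nat,
          [/\ iteration_count x xbar N,
              (* u0 <= 1 always holds here; at u0 = 1 the term ln (ln u0^-1)
                 is -oo and the displayed bound is +oo. *)
              u0 < 1 -> forall eps : R, 0 < eps ->
                count_le_ceil (N eps)
                  (1 + (ln (ln (c `^ (- (alpha - 1)^-1) * eps^-1))
                        - ln (ln u0^-1)) / ln alpha),
              u0 < 1 -> forall eps : R, 0 < eps -> eps <= d0 ->
                ln (ln u0^-1) <= ln (ln (c `^ (- (alpha - 1)^-1) * eps^-1))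
            & complexity N (fun eps => ln (ln eps^-1))]].
Proof.
move=> d0; have [Cx0 xS] := x_HiPPA.
have [Cxbar xbar_min] : argmin C f xbar by rewrite xbar_argmin.
pose d k := enorm (x k - xbar).
have d_ge0 k : 0 <= d k by exact: enorm_ge0.
have gam k : gmin < gamma k by have [/andP[]] := xS k.
have gam0 k : 0 < gamma k by exact: lt_trans (gam k).
have step k : [/\ 0 < d k.+1 -> d k.+1 < d k,
    forall a, (a%:E <= phi (d k.+1))%E ->
      gamma k * a <= d k `^ (p - 1) * d k.+1
  & 2 <= p -> forall a, (a%:E <= phi (d k.+1))%E ->
      gamma k * a <= d k `^ (p - 2) * (d k * d k.+1 - d k.+1 ^+ 2)].
  have [_ xmin] := xS k; have [CxS _] := xmin.
  exact: (prox_step f_notNy C_convex C_dom phi_modulus f_uqc p_gt1 (gam0 k)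
    xmin Cxbar (xbar_min _ CxS)).
have d_le k : d k.+1 <= d k.
  have [dlt _ _] := step k; have [/dlt/ltW//|] := ltP 0 (d k.+1).
  by move=> /le_trans; apply.
have p1 : 0 < p - 1 by lra.
split.
- move=> q rho q1 q2 rho0 phi_q qp p2 rho_gmin d_le1.
  have K1 : 1 < rho * gmin by rewrite -ltr_pdivrMl// mulr1.
  have K0 : 0 < rho * gmin := lt_trans ltr01 K1.
  have L0 : 0 < ln (rho * gmin) / (p - 1) by rewrite divr_gt0// ln_gt0.
  have [k|N [NP Nb NO]] := @linear_complexity _ _ x xbar _ L0.
    have [dlt dstep _] := step k.
    rewrite -/(d k) -/(d k.+1); apply: powR_contraction => //.
    have [dS|] := ltP 0 (d k.+1); last first.
      move=> dS; have -> : d k.+1 = 0 by apply/eqP; rewrite eq_le dS d_ge0.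
      by rewrite (@powR0 _ (p - 1)) ?gt_eqF// mulr0 powR_ge0.
    have dS1 : d k.+1 < 1 := lt_le_trans (dlt dS) (d_le1 k).
    have := growth_contraction q1 (d_ge0 _) (d_ge0 _)
      (dstep _ (phi_q _ (d_ge0 _) dS1)).
    (* As [d k.+1 < 1] and [q <= p], [d k.+1 ^ (p-1)] is at most [d k.+1 ^ (q-1)], so both sides get
       exponent [p - 1]. *)
    apply: le_trans; rewrite [rho * _]mulrC ler_pM ?powR_ge0 ?(ltW K0)//.
    + by rewrite mulr_ge0// ltW.
    + by rewrite ler_pM2r// ltW.
    + by rewrite ger_powR ?dS ?(ltW dS1)//; lra.
  exists N; split=> // eps eps0 _.
  have := Nb eps eps0.
  by congr (count_le_ceil _ (1 + _)); field; rewrite !gt_eqF ?ln_gt0.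
- move=> rho rho0 phi2 p2.
  have L0 : 0 < ln (1 + rho * gmin) by rewrite ln_gt0// ltrDl mulr_gt0.
  have [k|N [NP Nb NO]] := @linear_complexity _ _ x xbar _ L0; last by exists N.
  rewrite -/(d k) -/(d k.+1).
  have [_ _] := step k; rewrite p2 subrr powRr0 => /(_ (lexx _)).
  move=> /(_ _ (phi2 _ (d_ge0 _))); rewrite mul1r mulrA.
  move=> /(quadratic_contraction (d_ge0 _) (d_ge0 _)); apply: le_trans.
  rewrite lnK ?posrE ?addr_gt0 ?mulr_gt0// ler_wpM2l// lerD2l mulrC ler_pM2r//.
  exact: ltW.
- move=> rho p2 rho0 phi_p rho_gmin sigma.
  have K1 : 1 < gmin * rho by rewrite -ltr_pdivrMr// mul1r.
  have sigma0 : 0 < sigma by rewrite powR_gt0.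
  have sigma1 : sigma <= 1.
    by rewrite -(powRr0 2^-1) ger_powR// ?invr_gt0 ?ltr0n ?invf_le1 ?ler1n//; lra.
  have p0 : 0 < p by lra.
  (* The claimed factor is [gmin * rho + sigma / p], which this places below the available
     [gamma k * rho + 1]. *)
  have sigmap : sigma / p <= 1 by rewrite ler_pdivrMr//; lra.
  have KE : (p * gmin * rho + sigma) / p = gmin * rho + sigma / p.
    by field; rewrite gt_eqF.
  have sp0 : 0 < sigma / p by rewrite divr_gt0.
  have K'1 : 1 < gmin * rho + sigma / p by lra.
  have Kpos : 0 < p * gmin * rho + sigma by rewrite addr_gt0// -mulrA mulr_gt0//; lra.
  have L0 : 0 < (p - 1)^-1 * (ln (p * gmin * rho + sigma) - ln p).
    by rewrite mulr_gt0 ?invr_gt0// -ln_div ?posrE// KE ln_gt0.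
  have [k|N [NP Nb NO]] := @linear_complexity _ _ x xbar _ L0; last by exists N.
  rewrite -/(d k) -/(d k.+1) -ln_div ?posrE// KE [_^-1 * _]mulrC.
  have [_ _ dstep] := step k.
  apply: powR_contraction => //; first by lra.
  have := dstep (ltW p2) _ (phi_p _ (d_ge0 _)); rewrite mulrA.
  move=> /(power_contraction (ltW p2) (d_ge0 _) (d_le k)); apply: le_trans.
  rewrite ler_wpM2r ?powR_ge0// lerD// ler_pM2r//; exact: ltW.
move=> q rho q2 rho0 phi_q qp c alpha u0 d0_le.
have q1 : 1 < q by lra.
have q10 : 0 < q - 1 by lra.
have gr0 : 0 < gmin * rho by rewrite mulr_gt0.
have c0 : 0 < c by rewrite powR_gt0.
have al1 : 1 < alpha by rewrite /alpha ltr_pdivlMr//; lra.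
have u0_le1 : u0 <= 1.
  (* This is the assumption on [d0], because [1 / (alpha - 1) = (q - 1) / (p - q)]. *)
  rewrite /u0; have -> : (alpha - 1)^-1 = (q - 1) / (p - q).
    by rewrite /alpha; field; lra.
  by rewrite mulrC -ler_pdivlMr ?powR_gt0// mul1r -powRN.
have contr k : gamma k * rho * d k.+1 `^ (q - 1) <= d k `^ (p - 1).
  have [_ dstep _] := step k.
  exact: growth_contraction (dstep _ (phi_q _ (d_ge0 _))).
have cE : c `^ (q - 1) = (gmin * rho)^-1.
  rewrite /c -powRrM mulNr mul1r mulNr mulVf ?gt_eqF// powR_inv1//.
  exact: ltW.
(* The recursion is compared after raising to the power [q - 1], where [c] becomes [(gmin * rho)^-1]
   and [alpha] becomes [p - 1]. *)
have rE k : (c * d k `^ alpha) `^ (q - 1) = (gmin * rho)^-1 * d k `^ (p - 1).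
  rewrite powRM ?powR_ge0 ?(ltW c0)// cE -powRrM /alpha.
  by congr (_ * _ `^ _); field; lra.
have sup k : d k.+1 <= c * d k `^ alpha.
  rewrite leNgt; apply/negP => /(gt0_ltr_powR q10).
  rewrite !nnegrE mulr_ge0 ?powR_ge0// => /(_ isT (d_ge0 _)).
  rewrite rE ltNge ler_pdivlMl//; move=> /negP; apply.
  apply: le_trans (contr k); rewrite ler_wpM2r ?powR_ge0// ler_pM2r//.
  exact: ltW.
have sup0 : 0 < d 1%N -> d 1%N < c * d 0%N `^ alpha.
  move=> d1; rewrite ltNge; apply/negP => H.
  have : (c * d 0%N `^ alpha) `^ (q - 1) <= d 1%N `^ (q - 1).
    by rewrite ge0_ler_powR ?nnegrE ?mulr_ge0 ?powR_ge0 ?(ltW q10) ?(ltW c0).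
  rewrite rE ler_pdivrMl// leNgt => /negP; apply.
  apply: lt_le_trans (contr 0%N); rewrite ltr_pM2r ?powR_gt0// ltr_pM2r//.
have [N [NP Nb NO]] := @superlinear_complexity _ _ x xbar c alpha c0 al1 u0_le1 sup sup0.
exists N; split=> // u01 eps eps0 epsd.
(* It remains to compare the iterated logarithms: [eps <= d0] orders their arguments, and [u0 < 1]
   makes [ln u0^-1] positive. *)
have d00 : 0 < d0 := lt_le_trans eps0 epsd.
have cb0 : 0 < c `^ ((alpha - 1)^-1) by rewrite powR_gt0.
have u00 : 0 < u0 by rewrite mulr_gt0.
have lu0 : 0 < ln u0^-1 by rewrite ln_gt0// invf_gt1.
have u0_le : u0^-1 <= c `^ (- (alpha - 1)^-1) * eps^-1.
  by rewrite /u0 invfM powRN ler_pM2l ?invr_gt0// lef_pV2.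
have le_ln : ln u0^-1 <= ln (c `^ (- (alpha - 1)^-1) * eps^-1).
  by rewrite ler_ln ?posrE ?invr_gt0// mulr_gt0 ?powR_gt0 ?invr_gt0.
by rewrite ler_ln ?posrE// (lt_le_trans lu0).
Qed.
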